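(* For every integer $n\ge 3$, $$\zeta(2n)=\frac{\pi^{2n}}{6(4^n-1)}\sum_{\bar\lambda\in\mathcal M_{n-2}}\frac{\nu(\bar\lambda)}{\rho(\bar\lambda)} .$$
   Context: $\zeta$ is the Riemann zeta function. Motzkin paths: for $n\ge 1$, $\mathcal M_n$ is the set of Motzkin paths of $n$ steps, i.e. sequences $\bar\lambda=(\lambda_1,\dots,\lambda_n)\in\{-1,0,1\}^n$ with $\sum_{j=1}^n\lambda_j=0$ and $\sum_{j=1}^l\lambda_j\ge 0$ for all $l<n$. The map $\Phi$: let $S_m$ be the group of permutations of $\{1,\dots,m\}$. For $n\ge 1$ and $\sigma\in S_{n+1}$, $\Phi(\sigma)=(\lambda_1,\dots,\lambda_n)\in\{-1,0,1\}^n$ is defined as follows: for $1\le j\le n$, $\lambda_j+1$ is the number of neighbours of $j$ that are greater than $j$ in the list $0,\sigma(1),\sigma(2),\dots,\sigma(n+1),0$. For $\bar\lambda\in\{-1,0,1\}^n$, $\nu(\bar\lambda)$ is the number of permutations $\sigma\in S_{n+1}$ with $\Phi(\sigma)=\bar\lambda$, and $$\rho(\bar\lambda)=\prod_{i=1}^n(\lambda_1+\cdots+\lambda_i+2i+3)=(\lambda_1+5)(\lambda_1+\lambda_2+7)\cdots(\lambda_1+\cdots+\lambda_n+2n+3).$$ *)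

(* Defs.v *)
From mathcomp Require Import all_boot all_order all_algebra all_fingroup.
From mathcomp Require Import all_classical all_reals all_analysis.

Set Implicit Arguments.
Unset Strict Implicit.
Unset Printing Implicit Defensive.

Import Order.TTheory GRing.Theory Num.Theory numFieldNormedType.Exports.

Local Open Scope ring_scope.

(* The Riemann zeta function on the half-line s > 1, where it is the sum of
   its Dirichlet series; for other s the value carries no meaning. *)
Definition zeta (R : realType) (s : R) : R :=
  limn (series (fun k : nat => k.+1%:R `^ (- s))).

Notation step := (seq_sub [:: -1; 0; 1 : int]).

(* The tuple (lambda_1, ..., lambda_n) is indexed from 0: lambda_j is
   [lambda i] with [i = j - 1]. Hence [psum lambda l] is
   lambda_1 + ... + lambda_l. *)
Definition psum n (lambda : {ffun 'I_n -> step}) (l : nat) : int :=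
  \sum_(j < n | (j < l)%N) val (lambda j).

Definition Motzkin n : {set {ffun 'I_n -> step}} :=
  [set lambda : {ffun 'I_n -> step} |
    (psum lambda n == 0) && [forall l : 'I_n, 0 <= psum lambda l]].

(* The list 0, sigma(1), ..., sigma(m), 0, for sigma a permutation of
   {1, ..., m}; ['S_m] permutes {0, ..., m - 1}, hence the shift by one. *)
Definition padded m (sigma : 'S_m) : seq nat :=
  0%N :: rcons [seq (sigma i : nat).+1 | i <- enum 'I_m] 0%N.

(* The number of neighbours of j that are greater than j in [s]; meant for a
   j occurring exactly once in [s], and not at either end. *)
Definition greater_neighbours (s : seq nat) (j : nat) : nat :=
  let p := index j s in
  ((j < nth 0 s p.-1) + (j < nth 0 s p.+1))%N.

Lemma greater_neighbours_step s j :
  (greater_neighbours s j)%:Z - 1 \in [:: -1; 0; 1 : int].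
Proof. by rewrite /greater_neighbours; do 2!case: (_ < _)%N. Qed.

Definition Phi n (sigma : 'S_n.+1) : {ffun 'I_n -> step} :=
  [ffun i : 'I_n => SeqSub (greater_neighbours_step (padded sigma) i.+1)].

Definition nu n (lambda : {ffun 'I_n -> step}) : nat :=
  #|[set sigma : 'S_n.+1 | Phi sigma == lambda]|.

Definition rho n (lambda : {ffun 'I_n -> step}) : int :=
  \prod_(1 <= i < n.+1) (psum lambda i + i.*2%:Z + 3).

(* Main.v *)
Require Import Defs.
From mathcomp Require Import all_boot all_order all_algebra all_fingroup.
From mathcomp Require Import all_classical all_reals all_analysis.
From mathcomp Require Import zify ring lra.

Set Implicit Arguments.
Unset Strict Implicit.
Unset Printing Implicit Defensive.

Import Order.TTheory GRing.Theory Num.Theory numFieldNormedType.Exports.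

Local Open Scope ring_scope.

(** Inserting a new maximum into a permutation of [1, ..., m] at a gap between
two neighbours raises the number of greater neighbours of the larger of the two
by one and changes no other, and exactly [2 - g_j] gaps have maximum [j].  The
resulting recursion for the number of permutations with prescribed numbers of
greater neighbours is solved by
[nu lambda = \prod_i 'C(2, lambda_i + 1) (1 + lambda_1 + ... + lambda_(i-1))]
for every [lambda] of sum 0.
Let [T] be the power series with [tan t = t (1 + T (t^2))].  The equation
[tan' = 1 + tan^2] becomes [2 x T' + T = x (1 + T)^2], and a comparison of
coefficients shows that the weighted paths of length [m] that end at height
[k - 1] sum up to [3 / k] times the coefficient of [x^(m+1)] in [T^k].  For
[k = 1] this is three times a tangent coefficient.
Finally [2 * 4^n / pi^(2 n) \sum_(k odd) k^(-2 n)] satisfies the quadratic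
recursion of the tangent coefficients: a partial fraction argument gives
[\sum_(a + b = n) L a * L b = (n - 1/2) L n] for [L n = \sum_(k odd) k^(-2 n)], and
[L 1 = pi^2 / 8] follows by iterating
[1 / sin^2 x + 1 / cos^2 x = 4 / sin^2 (2 x)] from [x = pi / 4]. *)

(** * Permutations with given numbers of greater neighbours *)

(** Gap [k] is the place where [insert k] puts a new entry; the padding zeros supply the two outer
    gaps. *)
Definition gaps (s : seq nat) : seq (nat * nat) := pairmap pair 0%N (rcons s 0%N).

Definition gap_count (g : seq (nat * nat)) (j : nat) : nat :=
  (count (fun p => (p.1 == j) && (j < p.2)) g +
   count (fun p => (p.2 == j) && (j < p.1)) g)%N.

Lemma gap_count_cat g1 g2 j :
  gap_count (g1 ++ g2) j = (gap_count g1 j + gap_count g2 j)%N.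
Proof. rewrite /gap_count !count_cat; lia. Qed.

Lemma gap_count_cons x y g j : gap_count ((x, y) :: g) j =
  (((x == j) && (j < y)) + ((y == j) && (j < x)) + gap_count g j)%N.
Proof. rewrite /gap_count /=; lia. Qed.

Lemma gap_count_notin x s j :
  j != x -> j \notin s -> gap_count (pairmap pair x s) j = 0%N.
Proof.
elim: s x => [//|y s IHs] x jx; rewrite inE negb_or => /andP[jy js].
have := IHs y jy js; rewrite /gap_count /=.
by rewrite -!(eq_sym j) (negPf jx) (negPf jy).
Qed.

(** Splitting [s] at its only occurrence of [j] leaves just two gaps with end [j]; [0 < j] tells [j]
    from the padding. *)
Lemma greater_neighbours_gap_count s j :
  (0 < j)%N -> uniq s -> j \in s ->
  greater_neighbours (0%N :: rcons s 0%N) j = gap_count (gaps s) j.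
Proof.
move=> j0 + /splitPr js; case: js => s1 s2.
rewrite cat_uniq /= => /and3P[_]; rewrite negb_or => /andP[js1 _] /andP[js2 _].
rewrite /gaps rcons_cat rcons_cons pairmap_cat gap_count_cat gap_count_notin -?lt0n //.
have jr : j \notin rcons s2 0%N by rewrite mem_rcons inE negb_or -lt0n j0.
case E : (rcons s2 0%N) => [|y t]; first by case: s2 E {js2 jr}.
move: jr; rewrite E inE negb_or => /andP[jy jt].
rewrite /= !gap_count_cons gap_count_notin // /greater_neighbours.
have -> : index j (0%N :: s1 ++ [:: j, y & t]) = (size s1).+1.
  by rewrite /= eq_sym (negPf (lt0n_neq0 j0)) index_cat (negPf js1) /= eqxx addn0.
have -> : nth 0%N (0%N :: s1 ++ [:: j, y & t]) (size s1).+1.-1 = last 0%N s1.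
  rewrite /= (last_nth 0%N) -[_ :: _ ++ _]/((0%N :: s1) ++ _) nth_cat /=.
  by rewrite ltnSn.
have -> : nth 0%N (0%N :: s1 ++ [:: j, y & t]) (size s1).+2 = y.
  by rewrite /= nth_cat ltnNge leqnSn /= subSnn.
by rewrite !eqxx /= !ltnn; lia.
Qed.

(** * Inserting a new maximum into a word *)

Definition insert (k M : nat) (s : seq nat) := take k s ++ M :: drop k s.

Definition gap_max (s : seq nat) (k : nat) : nat :=
  let p := nth (0, 0)%N (gaps s) k in maxn p.1 p.2.

(** Every gap thus has a strictly larger end. The empty word is excluded because of its gap
    [(0, 0)]. *)
Lemma gaps_neq s : uniq s -> 0%N \notin s -> s != [::] ->
  all (fun p => p.1 != p.2) (gaps s).
Proof.
case: s => // y s us z _.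
have {us z} : uniq (0%N :: y :: s) by rewrite cons_uniq z.
rewrite /gaps.
suff H x t : t != [::] -> last x t != 0%N -> uniq (x :: t) ->
    all (fun p => p.1 != p.2) (pairmap pair x (rcons t 0%N)).
  move=> u; apply: H => //; apply: contraTneq u => E.
  by rewrite cons_uniq -{1}E /= mem_last.
elim: t x => [//|{}y [|w t] IHt] x _ ly /andP[/= ny u].
  by move: ny ly; rewrite inE /= => -> ->.
move: ny; rewrite inE negb_or => /andP[-> _] /=.
exact: (IHt y isT ly u).
Qed.

Lemma size_gaps s : size (gaps s) = (size s).+1.
Proof. by rewrite size_pairmap size_rcons. Qed.

(** A gap [(x, y)] becomes [(x, M)] and [(M, y)]. Its smaller end trades one greater neighbour for
    another, while its larger end gains one. *)
Lemma gap_count_insert s k M j :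
  uniq s -> 0%N \notin s -> s != [::] -> (k <= size s)%N -> (j < M)%N ->
  gap_count (gaps (insert k M s)) j = (gap_count (gaps s) j + (gap_max s k == j))%N.
Proof.
move=> us z s0 ks jM.
have /(all_nthP (0%N, 0%N)) /(_ k) := gaps_neq us z s0.
rewrite size_gaps ltnS => /(_ ks).
have := cat_take_drop k s; have := size_takel ks; rewrite /gap_max /insert.
move: (take k s) (drop k s) => s1 s2 <- <-.
rewrite /gaps !rcons_cat /= !pairmap_cat.
case E : (rcons s2 0%N) => [|y t]; first by case: s2 E.
rewrite /= nth_cat size_pairmap ltnn subnn /= => xy.
rewrite !gap_count_cat !gap_count_cons; move: xy jM. lia.
Qed.

Lemma gap_count_max s M : (forall x, x \in s -> x <= M)%N -> gap_count (gaps s) M = 0%N.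
Proof.
rewrite /gaps => H; have {}H x : x \in rcons s 0%N -> (x <= M)%N.
  by rewrite mem_rcons inE => /orP[/eqP->|/H].
suff G x t : (x <= M)%N -> (forall x, x \in t -> x <= M)%N ->
    gap_count (pairmap pair x t) M = 0%N by exact: G.
elim: t x {H} => // y t IHt x xM H.
have yM : (y <= M)%N by apply: H; rewrite mem_head.
have tM z : z \in t -> (z <= M)%N by move=> zt; apply: H; rewrite inE zt orbT.
by rewrite /= gap_count_cons IHt //; lia.
Qed.

(** Two gaps adjoin [j], and in each of them [j] either is the maximum or has a greater
    neighbour. *)
Lemma count_gap_max s j : uniq s -> 0%N \notin s -> j \in s ->
  (count (fun k => gap_max s k == j) (iota 0 (size s).+1) + gap_count (gaps s) j = 2)%N.
Proof.
move=> us z js; have s0 : s != [::] by case: (s) js.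
have j0 : 0%N != j by apply: contraNneq z => ->.
have gE : gaps s = [seq nth (0, 0)%N (gaps s) k | k <- iota 0 (size s).+1].
  by rewrite -size_gaps map_nth_iota0 // take_size.
have -> : count (fun k => gap_max s k == j) (iota 0 (size s).+1) =
  count (fun p => maxn p.1 p.2 == j) (gaps s) by rewrite gE count_map.
have : (count (pred1 j) [seq p.1 | p <- gaps s] + count (pred1 j) [seq p.2 | p <- gaps s] = 2)%N.
  have -> : [seq p.1 | p <- gaps s] = 0%N :: s.
    suff F x y t : [seq p.1 | p <- pairmap pair x (rcons t y)] = x :: t :> seq nat by exact: F.
    by elim: t x => [//|v t IHt] x /=; rewrite IHt.
  have -> : [seq p.2 | p <- gaps s] = rcons s 0%N.
    suff F x t : [seq p.2 | p <- pairmap pair x t] = t :> seq nat by exact: F.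
    by elim: t x => [//|v t IHt] x /=; rewrite IHt.
  rewrite -cats1 count_cat /= (negPf j0) (count_uniq_mem _ us) js //.
rewrite !count_map => <-.
elim: (gaps s) (gaps_neq us z s0) => // -[x y] g IHg /= /andP[xy /IHg].
by rewrite gap_count_cons; move: (count _ g) (count _ g) (count _ g) (gap_count g j) xy => a b c d; clear; lia.
Qed.

(** Insertion is inverted by recording the index of the maximum and removing it. *)
Lemma perm_permutations_insert m :
  perm_eq (permutations (iota 1 m.+1))
    [seq insert k m.+1 s | s <- permutations (iota 1 m), k <- iota 0 m.+1].
Proof.
have szm s : perm_eq s (iota 1 m) -> size s = m.
  by move=> /perm_size; rewrite size_iota.
have nM s : perm_eq s (iota 1 m) -> m.+1 \notin s.
  by move=> /perm_mem ->; rewrite mem_iota; lia.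
apply: uniq_perm; first exact: permutations_uniq.
  apply: allpairs_uniq; [exact: permutations_uniq|exact: iota_uniq|].
  move=> p q /allpairsP[[s k] [ps ks ->]] /allpairsP[[t l] [pt lt ->]] E.
  move: ps ks pt lt E; rewrite !mem_permutations !mem_iota !add0n !ltnS /= => ps ks pt lt E.
  have idx u i : perm_eq u (iota 1 m) -> (i <= m)%N -> index m.+1 (insert i m.+1 u) = i.
    move=> pu im; rewrite index_cat (contraNF (@mem_take _ _ _ _) (nM _ pu)) /= eqxx addn0.
    by rewrite size_takel // szm.
  have rm u i : perm_eq u (iota 1 m) -> rem m.+1 (insert i m.+1 u) = u.
    move=> pu; rewrite /insert -[in RHS](cat_take_drop i u).
    have := contraNN (@mem_take i _ u m.+1) (nM _ pu).
    elim: (take i u) => [|y v IHv] /=; first by rewrite eqxx.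
    by rewrite inE negb_or eq_sym => /andP[/negPf-> /IHv->].
  have := congr1 (index m.+1) E; rewrite !idx // => ->.
  by have := congr1 (rem m.+1) E; rewrite !rm // => ->.
move=> t; rewrite mem_permutations.
have pI : perm_eq (iota 1 m.+1) (m.+1 :: iota 1 m).
  by rewrite -[X in iota 1 X]addn1 iotaD add1n perm_catC.
rewrite (permPr pI); apply/idP/allpairsP => [pt|[[s k] /= [+ _ ->]]]; last first.
  rewrite mem_permutations => ps; rewrite /insert perm_sym -cat1s perm_sym.
  by rewrite perm_catC /= perm_cons perm_catC cat_take_drop.
have /splitPr tE : m.+1 \in t by rewrite (perm_mem pt) mem_head.
case: tE pt => t1 t2 pt.
have pt12 : perm_eq (t1 ++ t2) (iota 1 m).
  by move: pt; rewrite perm_catC /= perm_cons perm_catC.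
exists (t1 ++ t2, size t1); rewrite mem_permutations pt12 mem_iota /= add0n ltnS.
split=> //; first by rewrite -(szm _ pt12) size_cat leq_addr.
by rewrite /insert take_size_cat // drop_size_cat.
Qed.

Lemma gap_max_mem s k : uniq s -> 0%N \notin s -> s != [::] -> (k <= size s)%N ->
  gap_max s k \in s.
Proof.
move=> us z s0 ks; have /(all_nthP (0%N, 0%N)) /(_ k) := gaps_neq us z s0.
rewrite size_gaps ltnS => /(_ ks); rewrite /gap_max /gaps.
rewrite (nth_pairmap 0%N) ?size_rcons //=.
have mx l : nth 0%N (rcons s 0%N) l \in 0%N :: s.
  have [ls|ls] := leqP (size (rcons s 0%N)) l; first by rewrite nth_default ?mem_head.
  by have := mem_nth 0%N ls; rewrite mem_rcons.
have my l : nth 0%N (0%N :: rcons s 0%N) l \in 0%N :: s.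
  by case: l => [|l]; [exact: mem_head|exact: mx].
move: (mx k) (my k); rewrite !inE.
move: (nth 0%N (rcons s 0%N) k) (nth 0%N (0%N :: rcons s 0%N) k) => x y.
move=> /orP[/eqP->|xs] /orP[/eqP->|ys] //.
- by rewrite max0n.
- by rewrite /maxn; case: ltnP.
Qed.

(** * Counting words with prescribed numbers of greater neighbours *)

(** The prescription [w] is indexed from 1 and takes integer values, so that it can be lowered by
    one without truncation; a negative value gives the count 0. *)
Definition count_words (m : nat) (w : nat -> int) : nat :=
  count (fun s => all (fun j => (gap_count (gaps s) j)%:Z == w j) (iota 1 m))
        (permutations (iota 1 m)).

Lemma count_sumE (T : Type) (a : pred T) (r : seq T) :
  (count a r)%:Z = \sum_(x <- r) (a x)%:Z.
Proof. by elim: r => [|x r IHr]; rewrite ?big_nil // big_cons -IHr PoszD. Qed.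

Lemma count_words_max m w : w m.+1 != 0 -> count_words m.+1 w = 0%N.
Proof.
move=> wn; apply/eqP; rewrite -leqn0 leqNgt -has_count; apply/hasPn => s.
rewrite mem_permutations => ps; apply/allPn; exists m.+1.
  by rewrite mem_iota; lia.
rewrite gap_count_max 1?eq_sym // => x.
by rewrite (perm_mem ps) mem_iota; lia.
Qed.

(** Remove the maximum [m.+1] from a word and let [j] be the maximum of the gap it leaves. In the
    shorter word [j] has [w j - 1] greater neighbours, hence [2 - (w j - 1) = 3 - w j] gaps with
    maximum [j] were available for the insertion. *)
Lemma count_words_rec m w : (0 < m)%N -> w m.+1 = 0 ->
  (count_words m.+1 w)%:Z =
  \sum_(1 <= j < m.+1) (3 - w j) * (count_words m (fun i => w i - (i == j)%:Z))%:Z.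
Proof.
move=> m0 wn; rewrite /count_words count_sumE (perm_big _ (perm_permutations_insert m)).
have iE : iota 1 m.+1 = rcons (iota 1 m) m.+1.
  by rewrite -cats1 -[X in iota 1 X]addn1 iotaD add1n.
rewrite big_allpairs_dep iE.
under [RHS]eq_bigr do rewrite count_sumE mulr_sumr.
rewrite [RHS]exchange_big; apply: eq_big_seq => s; rewrite mem_permutations => ps.
have sz : size s = m by rewrite (perm_size ps) size_iota.
have us : uniq s by rewrite (perm_uniq ps) iota_uniq.
have z : 0%N \notin s by rewrite (perm_mem ps) mem_iota.
have s0 : s != [::] by rewrite -size_eq0 sz -lt0n.
(* For each gap exactly one [j] contributes, namely its maximum. *)
transitivity (\sum_(k <- iota 0 m.+1) \sum_(1 <= j < m.+1) (gap_max s k == j)%:Z *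
    (all (fun i => (gap_count (gaps s) i)%:Z == w i - (i == j)%:Z) (iota 1 m))%:Z).
  apply: eq_big_seq => k; rewrite mem_iota add0n ltnS => km.
  have := gap_max_mem us z s0 (k := k); rewrite sz => /(_ km) gm.
  rewrite (big_rem (gap_max s k)) /=; last by rewrite /index_iota subn1 -(perm_mem ps).
  rewrite eqxx mul1r big1_seq ?addr0 => [|j /= jr]; last first.
    by move: jr; rewrite mem_rem_uniq ?iota_uniq // inE eq_sym => /andP[/negPf->]; rewrite mul0r.
  congr (_%:Z); congr nat_of_bool.
  rewrite all_rcons wn.
  rewrite gap_count_max => [|x]; last first.
    rewrite /insert mem_cat inE orbCA -mem_cat cat_take_drop (perm_mem ps) mem_iota.
    lia.
  apply: eq_in_all => j; rewrite mem_iota => jm.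
  rewrite gap_count_insert ?sz //; last by lia.
  by rewrite PoszD eq_sym -subr_eq eq_sym [j == _]eq_sym.
rewrite exchange_big /=; apply: eq_big_seq => j.
rewrite mem_index_iota => jm.
rewrite -mulr_suml -count_sumE.
have js : j \in s by rewrite (perm_mem ps) mem_iota; lia.
case A : (all _ _); last by rewrite !mulr0.
move/allP/(_ j): A; rewrite mem_iota eqxx => /(_ ltac:(lia)) /eqP gj.
have := count_gap_max us z js; rewrite sz -[_ :: _]/(iota 0 m.+1) !mulr1.
by move: (count _ _) (gap_count _ _) (w j) gj => a b c; lia.
Qed.

(** With [w l] equal to lambda_l + 1 this is 1 + lambda_1 + ... + lambda_(i-1). *)
Definition height (w : nat -> int) (i : nat) : int := 1 + \sum_(1 <= l < i) (w l - 1).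

Definition choose2 (z : int) : int := if z is Posz k then 'C(2, k)%:Z else 0.

(** Absorption for binomial coefficients; it turns the number of gaps [3 - w j] into the factor
    [w j] that makes the recursion telescope. *)
Lemma choose2_rec z : (3 - z) * choose2 (z - 1) = z * choose2 z.
Proof.
case: z => [[|[|[|[|k]]]]|k] //; last by rewrite !mulr0.
have -> : k.+4%:Z - 1 = k.+3%:Z by lia.
by rewrite /= !bin_small // !mulr0.
Qed.

Lemma heightS w i : (0 < i)%N -> height w i.+1 = height w i + w i - 1.
Proof. by move=> i0; rewrite /height big_nat_recr //=; ring. Qed.

Lemma height1 w : height w 1 = 1.
Proof. by rewrite /height big_geq // addr0. Qed.

(* The height drops by at most one at each step, so it cannot become negative
   without vanishing first. *)
Lemma prod_height_ge0 w i : (0 < i)%N ->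
  \prod_(1 <= l < i) (choose2 (w l) * height w l) != 0 -> 0 <= height w i.
Proof.
elim: i => // -[_ _ _|i IHi _]; first by rewrite height1.
rewrite big_nat_recr //= !mulf_eq0 !negb_or => /andP[/IHi] /(_ isT) hi /andP[bi hn0].
have wi : 0 <= w i.+1 by case: (w i.+1) bi.
rewrite heightS //; lia.
Qed.

Lemma height_sub w j i : (0 < j)%N ->
  height (fun i => w i - (i == j)%:Z) i = height w i - (j < i)%:Z.
Proof.
move=> j0; elim: i => [|[|i] IHi]; first by rewrite /height !big_geq // ltn0 subr0.
  by rewrite !height1 ltnS leqNgt j0 subr0.
have -> : (j < i.+2)%N%:Z = (j < i.+1)%N%:Z + (i.+1 == j)%:Z by lia.
by rewrite heightS // IHi (heightS w (i := i.+1)) //; ring.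
Qed.

(** The hypothesis says that the values of [w] add up to [m]. Every word of length [m.+1] meets it,
    since each of its [m] inner gaps gives one greater neighbour. *)
Lemma count_wordsE m w : height w m.+2 = 0 ->
  (count_words m.+1 w)%:Z = \prod_(1 <= i < m.+2) (choose2 (w i) * height w i).
Proof.
elim: m w => [|m IHm] w.
  rewrite heightS // height1 big_nat1 height1 => w1.
  have -> : w 1%N = 0 by lia.
  have -> // : count_words 1 w = 1%N.
  by rewrite /count_words /= (_ : w 1%N = 0) //; lia.
rewrite heightS // big_nat_recr //= => h0.
have [wm|wm] := eqVneq (w m.+2) 0; last first.
  (* The product has to vanish too. A negative last value of [w] kills [choose2]; a positive one,
     with a nonnegative last height and final height 0, forces the last height to be 0. *)
  rewrite count_words_max //; apply/esym.
  have [->|/prod_height_ge0] := eqVneq (\prod_(1 <= l < m.+2) (choose2 (w l) * height w l)) 0.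
    by rewrite mul0r.
  move=> /(_ isT) hm.
  have [wneg|wpos] := leP 0 (w m.+2); last by case: (w m.+2) wpos => // k _; rewrite mul0r mulr0.
  have -> : height w m.+2 = 0 by lia.
  by rewrite !mulr0.
have hm : height w m.+2 = 1 by lia.
rewrite wm hm /= !mulr1 count_words_rec //.
(* The right-hand side of the recursion telescopes along [Q]. *)
pose Q j := height w j * \prod_(1 <= i < j) (choose2 (w i) * height w i) *
  \prod_(j <= i < m.+2) (choose2 (w i) * (height w i - 1)).
have -> : \prod_(1 <= i < m.+2) (choose2 (w i) * height w i) = Q m.+2 - Q 1%N.
  rewrite /Q [\prod_(1 <= i < m.+2) (_ * (_ - 1))]big_ltn // height1 subrr mulr0 mul0r mulr0 subr0.
  by rewrite hm mul1r [X in _ * X]big_geq // mulr1.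
rewrite -telescope_sumr //; apply: eq_big_nat => j /andP[j0 jm].
rewrite IHm; last by rewrite height_sub // hm jm.
have -> : \prod_(1 <= i < m.+2) (choose2 (w i - (i == j)%:Z) *
      height (fun i => w i - (i == j)%:Z) i) =
    \prod_(1 <= i < j) (choose2 (w i) * height w i) * (choose2 (w j - 1) * height w j) *
    \prod_(j.+1 <= i < m.+2) (choose2 (w i) * (height w i - 1)).
  rewrite (big_cat_nat (n := j)) //=; last by rewrite ltnW.
  rewrite [\prod_(j <= i < _) _]big_ltn // height_sub // ltnn eqxx subr0 mulrA.
  congr (_ * _ * _); apply: eq_big_nat => i /andP[].
    by move=> i0 ij; rewrite height_sub // (ltn_eqF ij) (ltnNge j) (ltnW ij) /= !subr0.
  by move=> ij im; rewrite height_sub // ij (gtn_eqF ij) subr0.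
rewrite /Q (heightS w j0) [\prod_(1 <= i < j.+1) _]big_nat_recr //=.
rewrite [\prod_(j <= i < m.+2) _]big_ltn //.
set A := \prod_(_ <= _ < _) _; set B := \prod_(_ <= _ < _) _.
(* With [h] the height at [j], going from [Q j] to [Q j.+1] replaces [h (h - 1)] by
   [(h + w j - 1) h], a difference of [w j] times [h]. *)
have := choose2_rec (w j); move: (choose2 (w j - 1)) (choose2 (w j)) => c d E.
transitivity ((3 - w j) * c * (A * height w j * B)); first by ring.
rewrite E; ring.
Qed.

(** * From permutations to words, and the formula for [nu] *)

Definition word m (sigma : 'S_m) : seq nat := [seq (sigma i : nat).+1 | i <- enum 'I_m].

Lemma word_perm m (sigma : 'S_m) : perm_eq (word sigma) (iota 1 m).
Proof.
have uw : uniq (word sigma).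
  rewrite map_inj_uniq ?enum_uniq // => i j [] /val_inj; exact: perm_inj.
rewrite perm_sym; apply: uniq_perm; rewrite ?iota_uniq //.
have sub : {subset word sigma <= iota 1 m}.
  by move=> _ /mapP[i _ ->]; rewrite mem_iota /= add1n ltnS ltn_ord.
have [|_ E x] := uniq_min_size uw sub; last by rewrite E.
by rewrite size_map size_iota -cardE card_ord.
Qed.

Lemma word_inj m : injective (@word m).
Proof.
move=> s t /eq_in_map st; apply/permP => i; apply: val_inj.
by have := st i; rewrite mem_enum => /(_ isT) [].
Qed.

Lemma perm_words m : perm_eq [seq word s | s <- enum 'S_m] (permutations (iota 1 m)).
Proof.
have uw : uniq [seq word s | s <- enum 'S_m].
  by rewrite (map_inj_uniq (@word_inj m)) enum_uniq.
apply: uniq_perm; rewrite ?permutations_uniq //.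
have sub : {subset [seq word s | s <- enum 'S_m] <= permutations (iota 1 m)}.
  by move=> _ /mapP[s _ ->]; rewrite mem_permutations word_perm.
have [|_ //] := uniq_min_size uw sub.
rewrite size_permutations ?iota_uniq // size_iota size_map -cardE.
by rewrite -card_Sn.
Qed.

(** The default -1 prescribes 0 greater neighbours for the entry [n.+1], which is what a maximum
    has. *)
Definition step_at n (lambda : {ffun 'I_n -> step}) (l : nat) : int :=
  oapp (fun i : 'I_n => val (lambda i)) (-1) (insub l).

Lemma step_at_ord n (lambda : {ffun 'I_n -> step}) (i : 'I_n) :
  step_at lambda i = val (lambda i).
Proof. by rewrite /step_at valK. Qed.

Lemma psumE n (lambda : {ffun 'I_n -> step}) i : (i <= n)%N ->
  psum lambda i = \sum_(0 <= l < i) step_at lambda l.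
Proof.
move=> im; rewrite big_mkord (big_ord_widen n (step_at lambda)) //.
by apply: eq_bigr => j _; rewrite step_at_ord.
Qed.

Lemma nu_count_words n (lambda : {ffun 'I_n -> step}) :
  nu lambda = count_words n.+1 (fun j => step_at lambda j.-1 + 1).
Proof.
rewrite /nu /count_words -(seq.permP (perm_words n.+1)) count_map cardE size_filter.
rewrite -enumT; apply: eq_count => s; rewrite !inE /=.
have pw := word_perm s; have uw : uniq (word s) by rewrite (perm_uniq pw) iota_uniq.
have gE j : (0 < j <= n.+1)%N -> greater_neighbours (padded s) j = gap_count (gaps (word s)) j.
  move=> /andP[j0 jn]; apply: greater_neighbours_gap_count => //.
  by rewrite (perm_mem pw) mem_iota; lia.
apply/eqP/(@allP _ _ (iota 1 n.+1)) => [<- j|H].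
  rewrite mem_iota => jn; have [jm|jm] := ltnP j.-1 n.
    rewrite (_ : step_at _ _ = step_at (Phi s) (Ordinal jm)) // step_at_ord ffunE /=.
    by rewrite prednK ?gE ?subrK //; lia.
  have -> : j = n.+1 by lia.
  rewrite /step_at insubN -?leqNgt //= gap_count_max // => x.
  by rewrite (perm_mem pw) mem_iota; lia.
apply/ffunP => i; apply: val_inj; rewrite ffunE /=.
rewrite gE; last by have := ltn_ord i; lia.
have /eqP-> := H i.+1 ltac:(rewrite mem_iota; have := ltn_ord i; lia).
by rewrite step_at_ord addrK.
Qed.

Lemma nuE n (lambda : {ffun 'I_n -> step}) : psum lambda n = 0 ->
  (nu lambda)%:Z = \prod_(i < n) (choose2 (val (lambda i) + 1) * (1 + psum lambda i)).
Proof.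
move=> p0; rewrite nu_count_words; set w := fun j => _.
have hE i : (i <= n)%N -> height w i.+1 = 1 + psum lambda i.
  move=> im; rewrite psumE // /height big_add1 /=.
  by congr (1 + _); apply: eq_bigr => l _; rewrite /w /= addrK.
have wn : w n.+1 = 0 by rewrite /w /step_at insubN -?leqNgt.
rewrite count_wordsE; last by rewrite heightS // hE // p0 wn.
rewrite big_nat_recr //= wn hE // p0 addr0. rewrite !mulr1 big_add1 /= big_mkord.
by apply: eq_bigr => i _; rewrite hE 1?ltnW // /w /= step_at_ord.
Qed.

(** * Powers of the tangent series and sums over paths *)

Section TangentPowers.
Variables (R : numFieldType) (c : nat -> R).
Hypothesis c1 : c 1 = 1.
(** The coefficient of t^(2 n - 2) in tan' = 1 + tan^2. *)
Hypothesis c_rec : forall n, (1 < n)%N ->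
  (2 * n - 1)%:R * c n = \sum_(1 <= a < n) c a * c (n - a)%N.

Variable M : nat.

(* For [c] the Taylor coefficients of [tan], with [c n] that of [t^(2 n - 1)], this
   is [T] cut off after [x^M], where [tan t = t (1 + T (t^2))]. *)
Definition tan_poly : {poly R} := \poly_(i < M.+1) (if i is k.+1 then c k.+2 else 0).

Local Notation T := tan_poly.

Lemma tan_poly_coef i : (i <= M)%N -> (1 + T)`_i = c i.+1.
Proof. by move=> iM; rewrite coefD coef1 coef_poly ltnS iM; case: i {iM} => [|i]; rewrite ?c1 ?addr0 ?add0r. Qed.

(* [tan' = 1 + tan^2], expressed in terms of [T] and [x = t^2]. *)
Definition tan_defect : {poly R} := 'X * T^`() *+ 2 + T - 'X * (1 + T) ^+ 2.

(** Up to x^M the truncation is not felt, and the coefficient of x^(i+1) is [c_rec] at [i.+2]. *)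
Lemma tan_defect_coef i : (i <= M)%N -> tan_defect`_i = 0.
Proof.
case: i => [|i] iM; rewrite /tan_defect coefB coefD coefMn !coefXM /=.
  by rewrite coef_poly /= mul0rn add0r subr0.
rewrite coef_deriv.
have -> : T`_i.+1 = c i.+2 by rewrite coef_poly ltnS iM.
rewrite expr2 coefM.
under eq_bigr => j _.
  rewrite !tan_poly_coef; try by have := ltn_ord j; lia.
  over.
have := c_rec (n := i.+2) isT; rewrite big_add1 big_mkord /= => E.
apply/eqP; rewrite subr_eq0; apply/eqP.
transitivity ((2 * i.+2 - 1)%:R * c i.+2).
  rewrite (_ : (2 * i.+2 - 1 = i.+1 * 2 + 1)%N); last by lia.
  by rewrite -mulrnA -mulrSr mulr_natl addn1.
rewrite E; apply: eq_bigr => j _; congr (_ * c _); have := ltn_ord j; lia.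
Qed.

Lemma tan_poly_exp_rec k i : (i < M)%N ->
  (2 * i.+1 + k.+1)%:R * (T ^+ k.+1)`_i.+1 =
  k.+1%:R * ((T ^+ k)`_i + 2 * (T ^+ k.+1)`_i + (T ^+ k.+2)`_i).
Proof.
move=> iM; have : (T ^+ k * tan_defect)`_i.+1 = 0.
  rewrite coefM big1 // => j _; rewrite tan_defect_coef ?mulr0 //.
  by have := leq_subr j i.+1; have := ltn_ord j; lia.
have -> : T ^+ k * tan_defect =
    'X * (T^`() * T ^+ k) *+ 2 + T ^+ k.+1 - 'X * (T ^+ k + T ^+ k.+1 *+ 2 + T ^+ k.+2).
  rewrite /tan_defect !exprS; ring.
rewrite coefB coefD coefMn !coefXM /= (coefD (_ + _)) (coefD (_ ^+ k)) coefMn => E.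
have D : (T ^+ k.+1)`_i.+1 *+ i.+1 = k.+1%:R * (T^`() * T ^+ k)`_i.
  by rewrite -coef_deriv deriv_exp coefMn mulr_natl.
have {}E : (T ^+ k)`_i + 2 * (T ^+ k.+1)`_i + (T ^+ k.+2)`_i =
   2 * (T^`() * T ^+ k)`_i + (T ^+ k.+1)`_i.+1.
  by apply/esym/eqP; rewrite -subr_eq0; apply/eqP; rewrite -[RHS]E; ring.
rewrite {}E mulrDr mulrCA -D natrD natrM -mulr_natl; ring.
Qed.

End TangentPowers.

(** * Weighted sums over step sequences by final height *)

Section PathSums.
Variable R : numFieldType.

Definition path_weight m (lambda : {ffun 'I_m -> step}) : R :=
  \prod_(i < m) ((choose2 (val (lambda i) + 1) * (1 + psum lambda i))%:~R /
                 (psum lambda i.+1 + i.+1.*2%:Z + 3)%:~R).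

(** No positivity is imposed: a sequence that reaches -1 before its end has a factor 0 in its
    weight. *)
Definition path_sum m (s : int) : R :=
  \sum_(lambda : {ffun 'I_m -> step} | psum lambda m == s) path_weight lambda.

Definition snoc (S : Type) m (f : {ffun 'I_m -> S}) (a : S) : {ffun 'I_m.+1 -> S} :=
  [ffun i => oapp f a (unlift ord_max i)].

Lemma snoc_widen (S : Type) m (f : {ffun 'I_m -> S}) (a : S) i :
  snoc f a (widen_ord (leqnSn m) i) = f i.
Proof.
rewrite ffunE (_ : widen_ord _ i = lift ord_max i) ?liftK //.
by apply: val_inj; rewrite /= /bump leqNgt ltn_ord.
Qed.

Lemma snoc_max (S : Type) m (f : {ffun 'I_m -> S}) (a : S) : snoc f a ord_max = a.
Proof. by rewrite ffunE unlift_none. Qed.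

Lemma sum_snoc (S : finType) m (P : pred {ffun 'I_m.+1 -> S}) (F : {ffun 'I_m.+1 -> S} -> R) :
  \sum_(f | P f) F f = \sum_(f : {ffun 'I_m -> S}) \sum_(a | P (snoc f a)) F (snoc f a).
Proof.
rewrite pair_big_dep /= (reindex (fun p : {ffun 'I_m -> S} * S => snoc p.1 p.2)) //.
exists (fun f : {ffun 'I_m.+1 -> S} => ([ffun i => f (widen_ord (leqnSn m) i)], f ord_max)).
  move=> [f a] _ /=; rewrite snoc_max; congr (_, _).
  by apply/ffunP => i; rewrite ffunE snoc_widen.
move=> f _ /=; apply/ffunP => i; rewrite ffunE; case: unliftP => [j|] -> //=.
rewrite ffunE; congr (f _); apply: val_inj.
by rewrite /= /bump leqNgt ltn_ord.
Qed.

Lemma sum_step (G : int -> R) : \sum_(a : step) G (val a) = G (-1) + G 0 + G 1.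
Proof.
rewrite -(big_map (fun a : step => val a) xpredT G).
have p : perm_eq [seq val a | a <- index_enum step] [:: -1; 0; 1 : int].
  apply: uniq_perm => [||x]; first by rewrite map_inj_uniq ?index_enum_uniq //; exact: val_inj.
    by [].
  apply/mapP/idP => [[a _ ->]|xs]; first exact: valP.
  by exists (SeqSub xs); rewrite ?mem_index_enum.
by rewrite (perm_big _ p) !big_cons big_nil /= addr0 addrA.
Qed.

Lemma psum_snoc m (f : {ffun 'I_m -> step}) a i : (i <= m)%N ->
  psum (snoc f a) i = psum f i.
Proof.
move=> im; rewrite /psum big_mkcond big_ord_recr /= ltnNge im /= addr0 [RHS]big_mkcond.
by apply: eq_bigr => j _; rewrite snoc_widen.
Qed.

Lemma psum_snocS m (f : {ffun 'I_m -> step}) a :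
  psum (snoc f a) m.+1 = psum f m + val a.
Proof.
rewrite /psum big_mkcond big_ord_recr /= ltnSn snoc_max [in RHS]big_mkcond /=.
by congr (_ + _); apply: eq_bigr => j _; rewrite snoc_widen ltnS ltnW ltn_ord.
Qed.

Lemma path_weight_snoc m (f : {ffun 'I_m -> step}) a :
  path_weight (snoc f a) = path_weight f *
   ((choose2 (val a + 1) * (1 + psum f m))%:~R /
    (psum f m + val a + m.+1.*2%:Z + 3)%:~R).
Proof.
rewrite /path_weight big_ord_recr /= snoc_max psum_snocS psum_snoc //; congr (_ * _).
by apply: eq_bigr => i _; rewrite snoc_widen !psum_snoc // ltnW.
Qed.

(** Split off the last step [a], which starts at height [s - a]; the steps 1, 0, -1 give the three
    terms. The bound on [s] keeps the denominator positive. *)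
Lemma path_sum_rec m (s : int) : -1 <= s ->
  (s + m.+1.*2%:Z + 3)%:~R * path_sum m.+1 s =
  s%:~R * path_sum m (s - 1) + (2 * (1 + s))%:~R * path_sum m s +
  (s + 2)%:~R * path_sum m (s + 1).
Proof.
move=> s1; rewrite /path_sum sum_snoc.
have dn0 : (s + m.+1.*2%:Z + 3)%:~R != 0 :> R by rewrite intr_eq0; lia.
rewrite [X in _ = _ * X + _ + _]big_mkcond [X in _ = _ + _ * X + _]big_mkcond.
rewrite [X in _ = _ + _ * X]big_mkcond !mulr_sumr -!big_split /=; apply: eq_bigr => f _.
under eq_bigl do rewrite psum_snocS.
rewrite (eq_bigr (fun a : step => path_weight f *
   ((choose2 (val a + 1) * (1 + (s - val a)))%:~R / (s + m.+1.*2%:Z + 3)%:~R))); last first.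
  by move=> a /eqP <-; rewrite path_weight_snoc addrK.
rewrite big_mkcond /= mulr_sumr.
rewrite (sum_step (fun z => _ * (if psum f m + z == s then path_weight f *
   ((choose2 (z + 1) * (1 + (s - z)))%:~R / (s + m.+1.*2%:Z + 3)%:~R) else 0))).
rewrite (_ : choose2 (-1 + 1) = 1) // (_ : choose2 (0 + 1) = 2) // (_ : choose2 (1 + 1) = 1) // !mul1r.
rewrite !opprK addr0 subr0.
rewrite (_ : (psum f m - 1 == s) = (psum f m == s + 1)); last by lia.
rewrite (_ : (psum f m + 1 == s) = (psum f m == s - 1)); last by lia.
set d := (_%:~R) in dn0 *.
have K (b : bool) (x : int) : d * (if b then path_weight f * (x%:~R / d) else 0) =
    x%:~R * (if b then path_weight f else 0).
  by case: b; rewrite ?mulr0 // mulrCA [x%:~R / d]mulrC mulVKf // mulrC.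
rewrite !K [LHS]addrC [X in _ + X = _]addrC addrA.
by congr (_%:~R * _ + _ + _%:~R * _); lia.
Qed.

End PathSums.

(** * The Motzkin sum as a tangent coefficient *)

Section MotzkinSum.
Variables (R : numFieldType) (c : nat -> R).
Hypothesis c1 : c 1 = 1.
Hypothesis c_rec : forall n, (1 < n)%N ->
  (2 * n - 1)%:R * c n = \sum_(1 <= a < n) c a * c (n - a)%N.

Lemma tan_poly_exp_coef0 M k : (tan_poly c M ^+ k)`_0 = (k == 0%N)%:R.
Proof.
by rewrite -horner_coef0 horner_exp horner_coef0 coef_poly /= expr0n.
Qed.

(** After multiplication by [k], [path_sum_rec] becomes [tan_poly_exp_rec]. The factor 3 fits the
    start [m = 0], since T = x/3 + .... *)
Lemma path_sumE M m k : (m < M)%N ->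
  k%:R * path_sum R m (k%:Z - 1) = 3 * (tan_poly c M ^+ k)`_m.+1.
Proof.
elim: m k => [|m IHm] [|k] mM; rewrite ?expr0 ?coef1 ?mul0r ?mulr0 //.
  have := tan_poly_exp_rec c1 c_rec k mM; rewrite !tan_poly_exp_coef0 /= mulr0 !addr0.
  rewrite /path_sum; under eq_bigl do rewrite /psum big_ord0.
  under eq_bigr do rewrite /path_weight big_ord0.
  have -> : k.+1%:Z - 1 = k by lia.
  case: k => [|k] E.
    rewrite big_const (_ : #|_| = 1%N) /= ?addr0; last first.
      rewrite (eq_card (B := predT)) // card_ffun card_ord expn0 //.
    by rewrite -E.
  rewrite big_pred0 //.
  have /eqP := E; rewrite mulr0 mulf_eq0 pnatr_eq0 addnS /= => /eqP->.
  by rewrite !mulr0.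
have dn0 : (2 * m.+2 + k.+1)%:R != 0 :> R by rewrite pnatr_eq0; lia.
apply: (mulfI dn0).
rewrite [RHS]mulrCA (tan_poly_exp_rec c1 c_rec k mM).
have -> : k.+1%:Z - 1 = k by lia.
have -> : (2 * m.+2 + k.+1)%:R = (k%:Z + m.+1.*2%:Z + 3)%:~R :> R.
  by rewrite [LHS]pmulrn; congr (_%:~R); lia.
rewrite mulrCA path_sum_rec; last by lia.
have mM' := ltnW mM.
have := IHm k mM'; have := IHm k.+1 mM'; have := IHm k.+2 mM'.
have -> : k.+1%:Z - 1 = k by lia.
have -> : k.+2%:Z - 1 = k%:Z + 1 by lia.
move=> E2 E1 E0; rewrite [RHS]mulrCA; congr (_ * _).
rewrite (_ : (2 * (1 + k%:Z))%:~R = 2 * k.+1%:R); last first.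
  by rewrite intrM; congr (_ * _); rewrite [RHS]pmulrn; congr (_%:~R); lia.
rewrite (_ : (k%:Z + 2)%:~R = k.+2%:R); first by rewrite !mulrDr -E0 -E2 [3 * (2 * _)]mulrCA -E1 mulrA.
by rewrite [RHS]pmulrn; congr (_%:~R); lia.
Qed.

(** Steps go down by at most one, and a nonzero weight forbids the height -1 before the end. *)
Lemma path_weight_neq0_Motzkin m (lambda : {ffun 'I_m -> step}) :
  psum lambda m = 0 -> path_weight R lambda != 0 -> lambda \in Motzkin m.
Proof.
move=> p0 /prodf_neq0 nz; rewrite inE p0 eqxx /=.
have H l : (l <= m)%N -> 0 <= 1 + psum lambda l.
  elim: l => [|l IHl] lm; first by rewrite psumE // big_geq.
  have := nz (Ordinal lm) isT; rewrite mulf_eq0 negb_or intr_eq0 mulf_eq0 negb_or => /andP[/andP[_ /= h0] _].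
  have := IHl (ltnW lm); rewrite !psumE // 1?ltnW // big_nat_recr //=.
  rewrite psumE 1?ltnW // in h0.
  rewrite -[l in step_at _ l]/(val (Ordinal lm)) step_at_ord.
  have : -1 <= val (lambda (Ordinal lm)) by have := valP (lambda (Ordinal lm)); rewrite !inE => /or3P[] /eqP->.
  have arith (a b : int) : 1 + a != 0 -> -1 <= b -> 0 <= 1 + a -> 0 <= 1 + (a + b) by lia.
  exact: arith h0.
apply/forallP => l; have := H l (ltnW (ltn_ord l)).
have := nz l isT; rewrite mulf_eq0 negb_or intr_eq0 mulf_eq0 negb_or => /andP[/andP[_ /= h0] _].
lia.
Qed.

Lemma nu_rhoE m (lambda : {ffun 'I_m -> step}) : psum lambda m = 0 ->
  (nu lambda)%:R / (rho lambda)%:~R = path_weight R lambda.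
Proof.
move=> p0; rewrite -[(nu lambda)%:R]/((nu lambda)%:Z%:~R) nuE // /rho.
by rewrite big_add1 big_mkord /= !rmorph_prod -prodf_div.
Qed.

Lemma sum_Motzkin m :
  \sum_(lambda in Motzkin m) (nu lambda)%:R / (rho lambda)%:~R = 3 * c m.+2 :> R.
Proof.
have := path_sumE 1 (ltnSn m); rewrite mul1r subrr expr1 coef_poly ltnSn => <-.
rewrite /path_sum big_mkcond [RHS]big_mkcond; apply: eq_bigr => lambda _.
have [lM|lM] := boolP (lambda \in Motzkin m).
  have p0 : psum lambda m == 0 by move: lM; rewrite inE => /andP[].
  by rewrite p0 nu_rhoE //; apply/eqP.
case: eqP => // p0; apply/esym/eqP; apply: contraNT lM; exact: path_weight_neq0_Motzkin.
Qed.

End MotzkinSum.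

(** * Even zeta values as tangent coefficients *)

Section OddBasel.
Variable R : realType.

Definition oddinv (q : nat) : R := (2 * q + 1)%:R^-1.

Definition odd_sum (s N : nat) : R := \sum_(0 <= q < N) oddinv q ^+ (2 * s).

Lemma oddinv_gt0 q : 0 < oddinv q.
Proof. by rewrite invr_gt0 ltr0n addn1. Qed.

Lemma oddinv_le1 q : oddinv q <= 1.
Proof. by rewrite invf_le1 ?ltr0n ?ler1n ?addn1. Qed.

Lemma sin_le_id (x : R) : 0 <= x -> sin x <= x.
Proof.
move=> x0; have [|c _] := @MVT_segment R sin cos 0 x x0.
  by apply: continuous_subspaceT; exact: continuous_sin.
by rewrite sin0 !subr0 => ->; rewrite ler_piMl // cos_le1.
Qed.

Lemma id_le_tan (x : R) : 0 <= x < pi / 2 -> x <= tan x.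
Proof.
move=> /andP[x0 xpi].
have cpos y : y \in `[0, x] -> 0 < cos y.
  rewrite in_itv /= => /andP[y0 yx]; apply: cos_gt0_pihalf.
  by rewrite (le_lt_trans yx xpi) andbT (lt_le_trans _ y0) // oppr_lt0 divr_gt0 ?pi_gt0.
have [| |c cx] := @MVT_segment R tan (fun y => (cos y) ^- 2) 0 x x0.
- move=> y yx; apply: is_derive_tan; rewrite gt_eqF // cpos //.
  by apply: subset_itv yx; rewrite bnd_simp.
- apply: derivable_within_continuous => y yx.
  by apply: derivable_tan; rewrite gt_eqF // cpos.
rewrite tan0 !subr0 => ->; by rewrite ler_peMl // invf_ge1 ?exprn_gt0 ?cpos.
Qed.

(** From sin x <= x <= tan x and 1 / sin^2 x = 1 + 1 / tan^2 x. *)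
Lemma cosec_bounds (x : R) : 0 < x < pi / 2 ->
  x ^- 2 <= (sin x) ^- 2 <= 1 + x ^- 2.
Proof.
move=> /andP[x0 xpi].
have s0 : 0 < sin x by rewrite sin_gt0_pihalf // x0.
have c0 : 0 < cos x.
  by apply: cos_gt0_pihalf; rewrite xpi andbT (lt_trans _ x0) // oppr_lt0 divr_gt0 ?pi_gt0.
apply/andP; split.
  by rewrite lef_pV2 ?posrE ?exprn_gt0 // ler_pXn2r ?nnegrE ?(ltW s0) ?(ltW x0) // sin_le_id // ltW.
have -> : (sin x) ^- 2 = 1 + (tan x) ^- 2.
  rewrite /tan; have := cos2Dsin2 x => E.
  rewrite expr_div_n invf_div -{1}(divff (x := sin x ^+ 2)) ?sqrf_eq0 ?gt_eqF //.
  by rewrite -mulrDl addrC E mul1r.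
rewrite lerD2l; have xt : x <= tan x by apply: id_le_tan; rewrite ltW.
have t0 : 0 < tan x by rewrite (lt_le_trans x0).
by rewrite lef_pV2 ?posrE ?exprn_gt0 // ler_pXn2r ?nnegrE ?(ltW t0) ?(ltW x0).
Qed.

Lemma cosec_double (x : R) : sin x != 0 -> cos x != 0 ->
  (sin x) ^- 2 + (cos x) ^- 2 = 4 * (sin (2 * x)) ^- 2.
Proof.
move=> s0 c0; rewrite (mulr_natl x 2) sin_mulr2n.
have := cos2Dsin2 x => E.
have -> : sin x ^- 2 + cos x ^- 2 = (cos x ^+ 2 + sin x ^+ 2) * (sin x ^- 2 * cos x ^- 2).
  by field; rewrite s0 c0.
by rewrite E -mulr_natr; field; rewrite s0 c0.
Qed.

Lemma sum_fold (F : nat -> R) n :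
  \sum_(0 <= k < n + n) F k = \sum_(0 <= k < n) (F k + F (n + n - k.+1)%N).
Proof.
rewrite (big_cat_nat (n := n)) ?leq_addr //= big_split /=; congr (_ + _).
rewrite big_nat_rev /= -{1}[n]add0n big_addn addnK.
by apply: eq_bigr => k _; congr F; lia.
Qed.

Definition odd_angle (m k : nat) : R := (2 * k + 1)%:R * pi / 2 ^+ m.+2.

Lemma odd_angle_range m k : (k < 2 ^ m)%N -> 0 < odd_angle m k < pi / 2.
Proof.
move=> km; rewrite /odd_angle; apply/andP; split.
  by rewrite divr_gt0 ?exprn_gt0 // mulr_gt0 ?pi_gt0 // ltr0n addn1.
rewrite ltr_pdivrMr ?exprn_gt0 //.
rewrite (_ : pi / 2 * 2 ^+ m.+2 = (2 * 2 ^ m)%:R * pi); last first.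
  by rewrite natrM natrX !exprS; field.
by rewrite ltr_pM2r ?pi_gt0 // ltr_nat; lia.
Qed.

Lemma odd_angleS m k : 2 * odd_angle m.+1 k = odd_angle m k.
Proof. by rewrite /odd_angle [2 ^+ m.+3]exprS; field; rewrite expf_neq0. Qed.

Lemma odd_angle_compl m k : (k < 2 ^ m)%N ->
  odd_angle m.+1 (2 ^ m + 2 ^ m - k.+1) = pi / 2 - odd_angle m.+1 k.
Proof.
move=> km; rewrite /odd_angle.
have -> : (2 * (2 ^ m + 2 ^ m - k.+1) + 1)%:R = 4 * 2 ^+ m - (2 * k + 1)%:R :> R.
  apply/eqP; rewrite eq_sym subr_eq -natrX -natrM -natrD eqr_nat; lia.
by rewrite !exprS; field; rewrite expf_neq0.
Qed.

(** At level [m.+1] the angles are paired with their complements; [cosec_double] turns each pair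
    into four times one term of level [m]. *)
Lemma sum_cosec m : \sum_(0 <= k < 2 ^ m) (sin (odd_angle m k)) ^- 2 = 2 * 4 ^+ m.
Proof.
elim: m => [|m IHm].
  have x0 : 0 < odd_angle 0 0 < pi / 2 by apply: odd_angle_range.
  have s0 : 0 < sin (odd_angle 0 0) by apply: sin_gt0_pihalf.
  have c2 : cos (odd_angle 0 0 *+ 2) = 0.
    by rewrite -[RHS](cos_pihalf R); congr cos; rewrite /odd_angle -mulr_natl !exprS; field.
  rewrite expn0 big_nat1 expr0 mulr1; move: c2; rewrite cos_mulr2n cos2sin2 => c2.
  have -> : sin (odd_angle 0 0) ^+ 2 = 2^-1 by lra.
  by rewrite invrK.
rewrite expnS mul2n -addnn sum_fold exprS mulrCA -IHm mulr_sumr; apply: eq_big_nat => k /andP[_ km].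
rewrite odd_angle_compl // sinB sin_pihalf cos_pihalf mul1r mul0r subr0.
have /andP[x0 xpi] : 0 < odd_angle m.+1 k < pi / 2.
  by apply: odd_angle_range; rewrite (leq_trans km) // leq_exp2l.
rewrite cosec_double ?odd_angleS // gt_eqF //.
  by rewrite sin_gt0_pihalf // x0.
by apply: cos_gt0_pihalf; rewrite xpi andbT (lt_trans _ x0) // oppr_lt0 divr_gt0 ?pi_gt0.
Qed.

(** Summing [cosec_bounds] over the [2 ^ m] angles costs at most [2 ^ m], against a total of order
    [4 ^ m]. *)
Lemma odd_sum_bounds m :
  pi ^+ 2 / 8 * (1 - (2 ^+ m.+1)^-1) <= odd_sum 1 (2 ^ m) <= pi ^+ 2 / 8.
Proof.
have p0 : pi != 0 :> R by rewrite gt_eqF ?pi_gt0.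
have E : \sum_(0 <= k < 2 ^ m) (odd_angle m k) ^- 2 = 4 ^+ m.+2 / pi ^+ 2 * odd_sum 1 (2 ^ m).
  rewrite mulr_sumr; apply: eq_bigr => k _; rewrite /odd_angle /oddinv.
  have k0 : (2 * k + 1)%:R != 0 :> R by rewrite pnatr_eq0 addn1.
  have -> : 4 ^+ m.+2 = (2 ^+ m.+2) ^+ 2 :> R by rewrite -exprM mulnC exprM; congr (_ ^+ _); ring.
  have : 2 ^+ m.+2 != 0 :> R by rewrite expf_neq0.
  move: (2 ^+ m.+2) (2 * k + 1)%:R (pi : R) p0 k0 => d a P P0 a0 d0.
  by field; rewrite a0 P0 d0.
have lo : 4 ^+ m.+2 / pi ^+ 2 * odd_sum 1 (2 ^ m) <= 2 * 4 ^+ m.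
  rewrite -E -sum_cosec; apply: ler_sum_nat => k /andP[_ km].
  by have /cosec_bounds/andP[] := odd_angle_range km.
have hi : 2 * 4 ^+ m <= 2 ^+ m + 4 ^+ m.+2 / pi ^+ 2 * odd_sum 1 (2 ^ m).
  have -> : 2 ^+ m = \sum_(0 <= k < 2 ^ m) 1 :> R.
    by rewrite big_const_nat subn0 iter_addr_0 natrX.
  rewrite -E -sum_cosec -big_split; apply: ler_sum_nat => k /andP[_ km].
  by have /cosec_bounds/andP[] := odd_angle_range km.
have q0 : 0 < 4 ^+ m.+2 / pi ^+ 2 :> R by rewrite divr_gt0 ?exprn_gt0 ?pi_gt0.
have A : 4 ^+ m.+2 / pi ^+ 2 * (pi ^+ 2 / 8) = 2 * 4 ^+ m :> R.
  by move: (pi : R) p0 => P P0; rewrite !exprS; field.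
have B : 4 ^+ m.+2 / pi ^+ 2 * (pi ^+ 2 / 8 * (1 - (2 ^+ m.+1)^-1)) = 2 * 4 ^+ m - 2 ^+ m :> R.
  rewrite mulrA A (_ : 4 ^+ m = 2 ^+ m * 2 ^+ m); first by rewrite exprS; field; rewrite expf_neq0.
  by rewrite -exprMn; congr (_ ^+ _); ring.
apply/andP; split; rewrite -(ler_pM2l q0); lra.
Qed.

Lemma odd_sum_ndecr s : {homo odd_sum s : N M / (N <= M)%N >-> N <= M}.
Proof.
move=> N M NM; rewrite /odd_sum [X in _ <= X](big_cat_nat (n := N)) //= lerDl.
by apply: sumr_ge0 => q _; rewrite exprn_ge0 // ltW // oddinv_gt0.
Qed.

(** The terms are largest for [s = 1], and [N <= 2 ^ N]. *)
Lemma odd_sum_le s N : (0 < s)%N -> odd_sum s N <= pi ^+ 2 / 8.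
Proof.
move=> s0; have /andP[_ h] := odd_sum_bounds N; apply: le_trans h.
apply: le_trans (odd_sum_ndecr 1 (ltnW (ltn_expl N (ltnSn 1)))).
apply: ler_sum_nat => q _; rewrite ler_wiXn2l ?oddinv_le1 ?(ltW (oddinv_gt0 q)) //.
by rewrite leq_pmul2l.
Qed.

Lemma odd_sum_cvg s : (0 < s)%N -> cvgn (odd_sum s).
Proof.
move=> s0; apply: nondecreasing_is_cvgn; first exact: odd_sum_ndecr.
by exists (pi ^+ 2 / 8) => _ [N _ <-]; exact: odd_sum_le.
Qed.

Definition odd_zeta s : R := limn (odd_sum s).

Lemma odd_zeta1 : odd_zeta 1 = pi ^+ 2 / 8.
Proof.
apply/eqP; rewrite eq_le; apply/andP; split.
  by apply: limr_le; [exact: odd_sum_cvg|apply: nearW => N; exact: odd_sum_le].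
have lb m : pi ^+ 2 / 8 * (1 - (2 ^+ m.+1)^-1) <= odd_zeta 1.
  have /andP[h _] := odd_sum_bounds m; apply: (le_trans h).
  by apply: nondecreasing_cvgn_le; [exact: odd_sum_ndecr|exact: odd_sum_cvg].
have cv : ((fun m => pi ^+ 2 / 8 * (1 - (2 ^+ m.+1)^-1)) @ \oo --> (pi ^+ 2 / 8 * (1 - 0) : R))%classic.
  apply: cvgMr; apply: cvgB; first exact: cvg_cst.
  have := cvg_geometric (2^-1 : R) (z := 2^-1); rewrite /geometric /=.
  rewrite (_ : (fun m => (2 ^+ m.+1)^-1) = (fun n => 2^-1 * 2^-1 ^+ n)); last first.
    by apply/funext => n; rewrite exprS invfM exprVn.
  by apply; rewrite gtr0_norm ?invf_lt1 ?invr_gt0 // ltr1n.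
rewrite subr0 mulr1 in cv; rewrite -(cvg_lim _ cv) //.
apply: limr_le; first by apply/cvg_ex; exists (pi ^+ 2 / 8).
by apply: nearW => m; exact: lb.
Qed.

End OddBasel.

(** * Partial fractions over the odd numbers *)

Section OddRecursion.
Variable R : realType.

Local Notation u := (fun q => oddinv R q ^+ 2).

Lemma natr_odd (p : nat) : (2 * p + 1)%:R = 2 * p%:R + 1 :> R.
Proof. by rewrite natrD natrM. Qed.

(* The value is [/ ((2 q + 1)^2 - (2 p + 1)^2)] and [0] at [q = p]; the last summand
   is there because [(q - p)^-1] is [0] at [q = p]. *)
Definition odd_kernel (p q : nat) : R :=
  oddinv R p / 4 * ((q%:R - p%:R)^-1 - (q + p + 1)%:R^-1) + (q == p)%:R * (oddinv R p ^+ 2 / 4).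

Lemma odd_kernelE p q : odd_kernel p q = (4 * ((q%:R - p%:R) * (q + p + 1)%:R))^-1.
Proof.
rewrite /odd_kernel /oddinv; have [->|qp] := eqVneq q p.
  rewrite subrr invr0 mul0r mulr0 invr0 mul1r sub0r addnn -mul2n.
  have : (2 * p + 1)%:R != 0 :> R by rewrite pnatr_eq0 addn1.
  by move: (2 * p + 1)%:R => a a0; field.
have d0 : q%:R - p%:R != 0 :> R by rewrite subr_eq0 eqr_nat.
have : (q + p + 1)%:R != 0 :> R by rewrite pnatr_eq0 addn1.
have : (2 * p + 1)%:R != 0 :> R by rewrite pnatr_eq0 addn1.
rewrite mul0r addr0 natr_odd !natrD; move: (q%:R : R) (p%:R : R) d0 => x y d0 p0 s0.
by field; rewrite p0 s0 d0.
Qed.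

Lemma odd_kernelC p q : odd_kernel q p = - odd_kernel p q.
Proof. by rewrite !odd_kernelE -opprB mulNr mulrN invrN (addnC p q). Qed.

(** What survives is a window of [2 * p + 1] consecutive reciprocals, which moves up by one place
    when [d] grows by one. *)
Lemma inv_telescope p d :
  \sum_(0 <= q < p.+1 + d) ((q%:R - p%:R)^-1 - (q + p + 1)%:R^-1) =
  - \sum_(d.+1 <= m < d + p + p + 2) m%:R^-1 :> R.
Proof.
elim: d => [|d IHd].
  rewrite addn0 big_split /= -[in RHS]sumrN [in RHS](big_cat_nat (n := p.+1)) //=; last by lia.
  congr (_ + _).
    rewrite big_nat_recr //= subrr invr0 addr0 big_add1 /= big_nat_rev /= add0n.
    apply: eq_big_nat => q /andP[_ qp].
    by rewrite -invrN natrB // addrAC subrr sub0r.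
  rewrite -[in RHS](add0n p.+1) big_addn (_ : (0 + p + p + 2 - p.+1 = p.+1)%N); last by lia.
  by apply: eq_big_nat => q _; congr (- _%:R^-1); lia.
rewrite addnS big_nat_recr //= IHd.
rewrite [X in - X + _]big_ltn; last by lia.
rewrite (_ : (d.+1 + p + p + 2 = (d + p + p + 2).+1)%N) // [X in _ = - X]big_nat_recr /=; last by lia.
rewrite (_ : (p.+1 + d)%:R - p%:R = d.+1%:R :> R); last by rewrite addSnnS natrD addrC addKr.
rewrite (_ : (p.+1 + d + p + 1 = d + p + p + 2)%N); last by lia.
ring.
Qed.

(** Each reciprocal in the window is at most 1 / (N - p), and their number cancels the factor
    [oddinv R p]. *)
Lemma sum_odd_kernel N p : (p < N)%N ->
  `|\sum_(0 <= q < N) odd_kernel p q - oddinv R p ^+ 2 / 4| <= (4 * (N - p)%:R)^-1.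
Proof.
move=> pN; rewrite /odd_kernel big_split /= -mulr_sumr -mulr_suml.
have -> : \sum_(0 <= q < N) (q == p)%:R = 1 :> R.
  rewrite (bigD1_seq p) ?iota_uniq ?mem_index_iota //= eqxx big1 ?addr0 //.
  by move=> q /negPf->.
rewrite mul1r addrK.
have NE : N = (p.+1 + (N - p.+1))%N by lia.
rewrite [in index_iota _ _]NE inv_telescope mulrN normrN ger0_norm; last first.
  rewrite mulr_ge0 ?divr_ge0 ?(ltW (oddinv_gt0 _ _)) //.
  by apply: sumr_ge0 => m _; rewrite invr_ge0.
have Np : 0 < (N - p)%:R :> R by rewrite ltr0n subn_gt0.
have : \sum_((N - p.+1).+1 <= m < N - p.+1 + p + p + 2) m%:R^-1 <= (2 * p + 1)%:R / (N - p)%:R :> R.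
  have -> : (2 * p + 1)%:R / (N - p)%:R =
      \sum_((N - p.+1).+1 <= m < N - p.+1 + p + p + 2) (N - p)%:R^-1 :> R.
    by rewrite big_const_nat iter_addr_0 -[RHS]mulr_natl; congr (_%:R / _); lia.
  apply: ler_sum_nat => m /andP[lm _]; rewrite lef_pV2 ?posrE ?ltr0n ?ler_nat; lia.
move=> S; apply: le_trans (ler_wpM2l _ S) _.
  by rewrite divr_ge0 ?(ltW (oddinv_gt0 _ _)).
rewrite /oddinv invfM le_eqVlt; apply/orP; left; apply/eqP.
have : (2 * p + 1)%:R != 0 :> R by rewrite pnatr_eq0 addn1.
move: ((2 * p + 1)%:R : R) ((N - p)%:R : R) Np => a b b0 a0.
by field; rewrite a0 gt_eqF.
Qed.

(** Off the diagonal this is a geometric sum with x = [u p], y = [u q], and x y / (x - y) is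
    [odd_kernel p q]; on the diagonal all [n - 1] terms agree. *)
Lemma sum_geometric n p q : (1 < n)%N ->
  \sum_(1 <= a < n) u p ^+ a * u q ^+ (n - a) =
  (q == p)%:R * (n - 1)%:R * u p ^+ n +
  (u p ^+ (n - 1) * odd_kernel p q + u q ^+ (n - 1) * odd_kernel q p).
Proof.
case: n => [|[|n]] // _; rewrite subn1 /=; have [->|qp] := eqVneq q p.
  rewrite [odd_kernel p p]odd_kernelE subrr mul0r mulr0 invr0 !mulr0 !addr0 mul1r.
  rewrite (eq_big_nat _ _ (F2 := fun=> u p ^+ n.+2)) => [|a /andP[a0 an]].
    by rewrite big_const_nat iter_addr_0 mulr_natl subn1.
  by rewrite -exprD subnKC // ltnW.
rewrite mul0r mul0r add0r [odd_kernel q p]odd_kernelC mulrN -mulrBl subrXX big_add1 big_mkord /=.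
rewrite odd_kernelE.
have d0 : q%:R - p%:R != 0 :> R by rewrite subr_eq0 eqr_nat.
have s0 : (q + p + 1)%:R != 0 :> R by rewrite pnatr_eq0 addn1.
have p0 : (2 * p + 1)%:R != 0 :> R by rewrite pnatr_eq0 addn1.
have q0 : (2 * q + 1)%:R != 0 :> R by rewrite pnatr_eq0 addn1.
have E : (u p - u q) * (4 * ((q%:R - p%:R) * (q + p + 1)%:R))^-1 = u p * u q.
  rewrite /oddinv; move: d0 s0 p0 q0; rewrite !natr_odd !natrD.
  move: (q%:R : R) (p%:R : R) => x y d0 s0 p0 q0.
  by field; rewrite p0 q0 d0 s0.
rewrite mulrAC E mulr_sumr; rewrite (reindex_inj rev_ord_inj) /=.
apply: eq_bigr => i _; have := ltn_ord i => ilt.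
rewrite mulrACA -!exprS; congr (_ ^+ _ * _ ^+ _); lia.
Qed.

End OddRecursion.

(** * The quadratic recursion in the limit, and the link to zeta *)

Section OddZetaRecursion.
Variable R : realType.

(** Write 1 / (N - p) as (1 + (p + 1) / (N - p)) / (N + 1), then use (p + 1) (N - p) >= N. Summed
    over [p], the error is of order 1 / N. *)
Lemma sum_oddinv_mul N p : (p < N)%N ->
  oddinv R p ^+ 2 / (N - p)%:R <= N.+1%:R^-1 * (oddinv R p ^+ 2 + N%:R^-1).
Proof.
move=> pN.
have Np : 0 < (N - p)%:R :> R by rewrite ltr0n subn_gt0.
have up : oddinv R p ^+ 2 <= p.+1%:R^-1 ^+ 2.
  rewrite ler_pXn2r ?nnegrE ?invr_ge0 ?ler0n ?(ltW (oddinv_gt0 _ _)) //.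
  by rewrite lef_pV2 ?posrE ?ltr0n ?ler_nat; lia.
have -> : oddinv R p ^+ 2 / (N - p)%:R =
    N.+1%:R^-1 * (oddinv R p ^+ 2 + oddinv R p ^+ 2 * (p.+1%:R / (N - p)%:R)).
  have e : N.+1%:R = p.+1%:R + (N - p)%:R :> R by rewrite -natrD; congr _%:R; lia.
  have : N.+1%:R != 0 :> R by rewrite pnatr_eq0.
  rewrite e; move: (p.+1%:R : R) ((N - p)%:R : R) Np => a b b0 ab0.
  by field; rewrite ab0 gt_eqF.
rewrite ler_pM2l ?invr_gt0 ?ltr0n // lerD2l.
apply: le_trans (_ : p.+1%:R^-1 ^+ 2 * (p.+1%:R / (N - p)%:R) <= _).
  by rewrite ler_wpM2r // divr_ge0.
rewrite expr2 mulrACA mulVf ?pnatr_eq0 // mul1r -invfM -natrM.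
rewrite lef_pV2 ?posrE ?ltr0n ?ler_nat ?muln_gt0; nia.
Qed.

(** The diagonal p = q yields the factor n - 1. The two kernel sums agree by symmetry and are each
    close to a quarter of [odd_sum R n N], which makes n - 1/2 in all. *)
Lemma odd_sum_conv n N : (1 < n)%N ->
  `|\sum_(1 <= a < n) odd_sum R a N * odd_sum R (n - a) N - (n%:R - 2^-1) * odd_sum R n N|
    <= N.+1%:R^-1 * (pi ^+ 2 / 8 + 1).
Proof.
move=> n1.
have -> : \sum_(1 <= a < n) odd_sum R a N * odd_sum R (n - a) N =
    \sum_(0 <= p < N) \sum_(0 <= q < N) \sum_(1 <= a < n)
      (oddinv R p ^+ 2) ^+ a * (oddinv R q ^+ 2) ^+ (n - a).
  under [RHS]eq_bigr do rewrite exchange_big /=.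
  rewrite [RHS]exchange_big /=; apply: eq_bigr => a _.
  rewrite /odd_sum mulr_suml; apply: eq_bigr => p _.
  by rewrite mulr_sumr; apply: eq_bigr => q _; rewrite -!exprM.
under eq_bigr do under eq_bigr do rewrite sum_geometric //.
under eq_bigr do rewrite big_split /=.
rewrite big_split /=.
have -> : \sum_(0 <= p < N) \sum_(0 <= q < N) (q == p)%:R * (n - 1)%:R * (oddinv R p ^+ 2) ^+ n =
    (n%:R - 1) * odd_sum R n N.
  rewrite mulr_sumr; apply: eq_big_nat => p pN.
  rewrite (bigD1_seq p) ?iota_uniq ?mem_index_iota //= eqxx big1 ?addr0 => [|q /negPf->].
    by rewrite mul1r natrB 1?ltnW // -exprM.
  by rewrite !mul0r.
under eq_bigr do rewrite big_split /=.
rewrite big_split /= [X in _ + (_ + X)]exchange_big /=.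
set S := \sum_(0 <= p < N) _.
have SE : S = \sum_(0 <= p < N) (oddinv R p ^+ 2) ^+ (n - 1) * \sum_(0 <= q < N) odd_kernel R p q.
  by apply: eq_bigr => p _; rewrite mulr_sumr.
have OE : odd_sum R n N = 4 * \sum_(0 <= p < N) (oddinv R p ^+ 2) ^+ (n - 1) * (oddinv R p ^+ 2 / 4).
  rewrite mulr_sumr; apply: eq_bigr => p _.
  by rewrite exprM -[in LHS](subnK (ltnW n1)) addn1 exprSr; field.
have -> : (n%:R - 1) * odd_sum R n N + (S + S) - (n%:R - 2^-1) * odd_sum R n N =
    2 * (S - 4^-1 * odd_sum R n N) by field.
rewrite OE mulrA mulVf ?mul1r // SE -sumrB normrM ger0_norm //.
have H : `|\sum_(0 <= p < N) ((oddinv R p ^+ 2) ^+ (n - 1) * \sum_(0 <= q < N) odd_kernel R p q -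
     (oddinv R p ^+ 2) ^+ (n - 1) * (oddinv R p ^+ 2 / 4))| <=
   \sum_(0 <= p < N) N.+1%:R^-1 * (oddinv R p ^+ 2 + N%:R^-1) / 4.
  apply: le_trans (ler_norm_sum _ _ _) _; apply: ler_sum_nat => p /andP[_ pN].
  rewrite -mulrBr normrM ger0_norm ?exprn_ge0 ?(ltW (oddinv_gt0 _ _)) //.
  have u1 : (oddinv R p ^+ 2) ^+ (n - 1) <= oddinv R p ^+ 2.
    rewrite -[X in _ <= X]expr1 ler_wiXn2l ?exprn_ge0 ?(ltW (oddinv_gt0 _ _)) //; last by lia.
    by rewrite expr_le1 // ?(ltW (oddinv_gt0 _ _)) // oddinv_le1.
  apply: le_trans (ler_pM _ _ u1 (sum_odd_kernel R pN)) _.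
  - by rewrite !exprn_ge0 ?(ltW (oddinv_gt0 _ _)).
  - exact: normr_ge0.
  - by rewrite invfM mulrCA mulrC ler_pM2r ?invr_gt0 // sum_oddinv_mul.
apply: le_trans (ler_wpM2l _ H) _ => //.
rewrite -mulr_suml -mulr_sumr big_split /= big_const_nat subn0 iter_addr_0.
have h1 : \sum_(0 <= p < N) oddinv R p ^+ 2 <= pi ^+ 2 / 8 by exact: (odd_sum_le R N (ltnSn 0)).
have h2 : N%:R^-1 *+ N <= 1 :> R.
  by case: N {S SE OE H h1} => [|N]; rewrite ?mulr0n // -(mulr_natr (_^-1)) mulVf ?pnatr_eq0.
have h0 : 0 <= N.+1%:R^-1 :> R by rewrite invr_ge0.
have h3 := ler_wpM2l h0 (lerD h1 h2).
have h4 : 0 <= N.+1%:R^-1 * (pi ^+ 2 / 8 + 1) :> R.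
  by rewrite mulr_ge0 // addr_ge0 // divr_ge0 ?exprn_ge0 ?pi_ge0.
by move: (_ * (_ + _ *+ _)) (_ * (_ + 1)) h3 h4 => x y; lra.
Qed.

Lemma odd_zeta_conv n : (1 < n)%N ->
  \sum_(1 <= a < n) odd_zeta R a * odd_zeta R (n - a) = (n%:R - 2^-1) * odd_zeta R n.
Proof.
move=> n1.
pose f N := \sum_(1 <= a < n) odd_sum R a N * odd_sum R (n - a) N - (n%:R - 2^-1) * odd_sum R n N.
have cv s : (0 < s)%N -> (odd_sum R s @ \oo --> odd_zeta R s)%classic by exact: odd_sum_cvg.
have f1 : (f @ \oo --> \sum_(1 <= a < n) odd_zeta R a * odd_zeta R (n - a) -
    (n%:R - 2^-1) * odd_zeta R n)%classic.
  apply: cvgB; last by apply: cvgMr; apply: cv; lia.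
  under eq_fun do rewrite big_nat_cond.
  rewrite big_nat_cond; apply: cvg_big; first exact: add_continuous.
  by move=> a /andP[/andP[a0 an] _]; apply: cvgM; apply: cv; lia.
have f0 : (f @ \oo --> (0 : R))%classic.
  have g0 : ((fun N => N.+1%:R^-1 * (pi ^+ 2 / 8 + 1)) @ \oo --> (0 : R))%classic.
    by rewrite -(mul0r (pi ^+ 2 / 8 + 1 : R)); apply: cvgMl; exact: cvg_harmonic.
  apply/norm_cvg0P; apply: (squeeze_cvgr _ (cvg_cst 0) g0).
  by apply: nearW => N; rewrite normr_ge0 odd_sum_conv.
by apply/eqP; rewrite -subr_eq0; apply/eqP; exact: (cvg_unique _ f1 f0).
Qed.

Lemma zeta_even n : (0 < n)%N ->
  zeta ((2 * n)%:R : R) * (4 ^+ n - 1) = 4 ^+ n * odd_zeta R n.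
Proof.
move=> n0; rewrite /zeta.
pose S N : R := \sum_(0 <= k < N) k.+1%:R^-1 ^+ (2 * n).
have -> : series (fun k : nat => k.+1%:R `^ (- (2 * n)%:R)) = S.
  apply/funext => N; rewrite /series /=; apply: eq_bigr => k _.
  by rewrite powRN powR_mulrn // exprVn.
(* Odd and even denominators are separated; this gives both the bound and the limit equation. *)
have SD N : S (2 * N)%N = odd_sum R n N + 4^-1 ^+ n * S N.
  elim: N => [|N IHN]; first by rewrite /S /odd_sum !big_geq // mulr0 addr0.
  rewrite mulnS !addSn add0n /S !big_nat_recr //= -/(S _) IHN /odd_sum big_nat_recr //=.
  rewrite -/(odd_sum R n N) mulrDr -/(S N).
  have -> : (2 * N).+2%:R^-1 ^+ (2 * n) = 4^-1 ^+ n * N.+1%:R^-1 ^+ (2 * n) :> R.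
    have -> : 4^-1 = 2^-1 ^+ 2 :> R by field.
    rewrite -exprM -exprMn -invfM -natrM; congr (_%:R^-1 ^+ _); lia.
  by rewrite /oddinv addn1; ring.
have Snd : {homo S : N M / (N <= M)%N >-> N <= M}.
  move=> N M NM; rewrite /S [X in _ <= X](big_cat_nat (n := N)) //= lerDl.
  by apply: sumr_ge0 => q _; rewrite exprn_ge0 // invr_ge0.
(* S N <= S (2 N) <= pi^2 / 8 + S N / 4. *)
have Sb N : S N <= pi ^+ 2 / 6.
  have h1 := odd_sum_le R N n0.
  have h2 : S N <= S (2 * N)%N by apply: Snd; lia.
  have S0 : 0 <= S N by apply: sumr_ge0 => q _; rewrite exprn_ge0 // invr_ge0.
  have h3 : 4^-1 ^+ n * S N <= 4^-1 * S N.
    by rewrite ler_wpM2r // -[X in _ <= X]expr1 ler_wiXn2l // invf_le1 // ler1n.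
  rewrite SD in h2; lra.
have Scv : cvgn S.
  by apply: nondecreasing_is_cvgn => //; exists (pi ^+ 2 / 6) => _ [N _ <-].
have e : limn S = odd_zeta R n + 4^-1 ^+ n * limn S.
  have c1 : ((fun N => S (2 * N)%N) @ \oo --> limn S)%classic.
    by apply: cvg_comp Scv; exact: cvg_mulnl.
  have c2 : ((fun N => S (2 * N)%N) @ \oo --> odd_zeta R n + 4^-1 ^+ n * limn S)%classic.
    under eq_fun do rewrite SD.
    by apply: cvgD; [exact: odd_sum_cvg|exact: cvgMr].
  exact: (cvg_unique _ c1 c2).
have q0 : 4 ^+ n != 0 :> R by rewrite expf_neq0.
have -> : odd_zeta R n = limn S - 4^-1 ^+ n * limn S by rewrite {1}e addrK.
by rewrite exprVn; field.
Qed.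

End OddZetaRecursion.

(** * Tangent coefficients and the conclusion *)

Section TangentCoefficients.
Variable R : realType.

(** The coefficient of t^(2 n - 1) in the partial fraction expansion of tan t. *)
Definition tan_coef (n : nat) : R := 2 * 4 ^+ n / pi ^+ (2 * n) * odd_zeta R n.

Lemma tan_coef1 : tan_coef 1 = 1.
Proof.
have p0 : pi != 0 :> R by rewrite gt_eqF ?pi_gt0.
rewrite /tan_coef odd_zeta1; move: (pi : R) p0 => P P0.
by rewrite expr1 muln1; field.
Qed.

Lemma tan_coef_rec n : (1 < n)%N ->
  (2 * n - 1)%:R * tan_coef n = \sum_(1 <= a < n) tan_coef a * tan_coef (n - a).
Proof.
move=> n1; have p0 : pi != 0 :> R by rewrite gt_eqF ?pi_gt0.
transitivity (4 * 4 ^+ n / pi ^+ (2 * n) *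
    \sum_(1 <= a < n) odd_zeta R a * odd_zeta R (n - a)).
  rewrite odd_zeta_conv // /tan_coef natrB; last by lia.
  rewrite natrM; field; exact: expf_neq0.
rewrite mulr_sumr; apply: eq_big_nat => a /andP[_ an].
have e1 : pi ^+ (2 * n) = pi ^+ (2 * a) * pi ^+ (2 * (n - a)) :> R.
  by rewrite -exprD -mulnDr subnKC // ltnW.
have e2 : 4 ^+ n = 4 ^+ a * 4 ^+ (n - a) :> R by rewrite -exprD subnKC // ltnW.
rewrite /tan_coef e1 e2.
have := expf_neq0 (2 * a) p0; have := expf_neq0 (2 * (n - a)) p0.
move: (pi ^+ (2 * a)) (pi ^+ (2 * (n - a))) => x y y0 x0.
by field; rewrite x0 y0.
Qed.

End TangentCoefficients.

Theorem mainTheorem3 (R : realType) (n : nat) (hn : (3 <= n)%N) :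
  zeta ((2 * n)%:R : R) =
  pi ^+ (2 * n) / (6 * (4 ^+ n - 1)) *
  \sum_(lambda in Motzkin (n - 2)) (nu lambda)%:R / (rho lambda)%:~R.
Proof.
have n0 : (0 < n)%N by apply: leq_trans hn.
have p0 : pi != 0 :> R by rewrite gt_eqF ?pi_gt0.
have d0 : 4 ^+ n - 1 != 0 :> R.
  by rewrite subr_eq0 gt_eqF // exprn_egt1 ?ltr1n // -lt0n.
rewrite (sum_Motzkin (tan_coef1 R) (@tan_coef_rec R)).
rewrite (_ : (n - 2).+2 = n); last by lia.
(* Both sides become 4^n times [odd_zeta R n]: the 3 of [sum_Motzkin] and the 2 of [tan_coef] cancel
   the 6. *)
apply: (mulIf d0); rewrite zeta_even // /tan_coef.
have := expf_neq0 (2 * n) p0; move: (pi ^+ (2 * n)) (4 ^+ n) d0 => x y y0 x0.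
by field; rewrite x0 y0.
Qed.
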